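(* Let $M$ be a simple matroid of rank $r$. For $0\le k\le r$, \[ h_k^0(M)\le h_k^\beta(M)\le W_{r-k}(M), \] and $h_0^\beta(M)=h_r^\beta(M)=1$.
   Context: Let $M$ be a simple matroid of rank $r$ on a finite ground set $E$, and let $L=L(M)$ be its lattice of flats, a geometric lattice with rank function $\mathrm{rk}$, bottom $\hat 0$, top $\hat 1$, and atom set $A$ (identified with $E$). $L_k$ is the set of flats of rank $k$ and $W_k(M)=|L_k|$. $\mathbb R[L]$ is the real vector space with basis $(e_x)_{x\in L}$. For an atom $a$, the linear operator $L_a$ on $\mathbb R[L]$ is $L_ae_x=e_{x\vee a}$ if $a\not\le x$, and $L_ae_x=0$ if $a\le x$. For $x\in L_k$, $\beta_x$ is the number of ordered atom bases of $x$, i.e. of tuples $(a_1,\dots,a_k)\in A^k$ with $a_1\vee\dots\vee a_k=x$ (so $\beta_{\hat 0}=1$). Put $v_k=\sum_{x\in L_k}\beta_xe_x$; in particular $v_r=\beta_{\hat 1}e_{\hat 1}$. Equip $\mathbb R[L]$ with the inner product $\langle e_x,e_y\rangle_\beta=\delta_{x,y}/\beta_x$ and let $L_a^\beta$ be the adjoint of $L_a$ for it. Put $U^\beta=\sum_{a\in A}L_a^\beta$, $Ke_x=\mathrm{rk}(x)e_x$, $s(x)=|A|-|\{a\in A:a\le x\}|$, and $S^{-1}e_x=s(x)^{-1}e_x$ for $x<\hat 1$, $S^{-1}e_{\hat 1}=0$. Define $D_\beta=S^{-1}U^\beta K$. Define $\mathcal C_0^\beta(M)=\mathbb R v_r$ and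 $\mathcal C_{k+1}^\beta(M)=D_\beta\mathcal C_k^\beta(M)+\sum_{a\in A}L_a^\beta\mathcal C_k^\beta(M)$; put $h_k^\beta(M)=\dim\mathcal C_k^\beta(M)$. Define $\mathcal C_k^0(M)=\mathrm{span}\{L_{a_k}^\beta\cdots L_{a_1}^\beta v_r:a_1,\dots,a_k\in E\}$ and $h_k^0(M)=\dim\mathcal C_k^0(M)$. *)

(* Defs.v *)
From HB Require Import structures.
From mathcomp Require Import all_boot all_order all_algebra.
From mathcomp Require Import reals.
From mathcomp Require classical_sets.

Set Implicit Arguments.
Unset Strict Implicit.
Unset Printing Implicit Defensive.

Import Order.TTheory GRing.Theory Num.Theory.

Local Open Scope ring_scope.

Record matroid (E : finType) := Matroid {
  indep : {set E} -> bool;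
  indep0 : indep set0;
  indepS : forall I J : {set E}, I \subset J -> indep J -> indep I;
  indep_aug : forall I J : {set E}, indep I -> indep J -> (#|I| < #|J|)%N ->
    exists2 x, x \in J :\: I & indep (x |: I)
}.

(* Neither loops nor pairs of distinct parallel elements. *)
Definition simple_matroid (E : finType) (M : matroid E) : Prop :=
  (forall a : E, indep M [set a]) /\
  (forall a b : E, a != b -> indep M [set a; b]).

Section RankClosure.
Variables (E : finType) (M : matroid E).
Implicit Types (A B I J : {set E}).

Definition mrank A : nat :=
  (\max_(I : {set E} | indep M I && (I \subset A)) #|I|)%N.

Definition mclosure A : {set E} := [set x | mrank (x |: A) == mrank A].

Definition is_flat A : bool := mclosure A == A.

Lemma mrank_ge I A : indep M I -> I \subset A -> (#|I| <= mrank A)%N.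
Proof.
move=> iI IA; rewrite /mrank.
by apply: (bigop.bigmax_sup I) => //; rewrite iI.
Qed.

Lemma mrankS A B : A \subset B -> (mrank A <= mrank B)%N.
Proof.
move=> AB; apply/bigop.bigmax_leqP => I /andP[iI IA].
exact: mrank_ge iI (subset_trans IA AB).
Qed.

Lemma mrank_basis A : exists I, [/\ indep M I, I \subset A & #|I| = mrank A].
Proof.
have [|I /andP[iI IA] eI] := @bigop.eq_bigmax_cond _
  (fun I : {set E} => indep M I && (I \subset A)) (fun I : {set E} => #|I|).
  by apply/card_gt0P; exists set0; rewrite unfold_in indep0 sub0set.
by exists I.
Qed.

Lemma basis_extend I A : indep M I -> I \subset A ->
  exists J, [/\ indep M J, I \subset J, J \subset A & #|J| = mrank A].
Proof.
have [n] := ubnP (mrank A - #|I|)%N.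
elim: n I => // n IHn I ltn iI IA.
have := mrank_ge iI IA; rewrite leq_eqVlt => /predU1P[eI | ltI].
  by exists I.
have [B [iB BA eB]] := mrank_basis A.
have [|x /[!inE] /andP[xI xB] ixI] := @indep_aug _ M I B iI iB.
  by rewrite eB.
have [||J [iJ sJ JA eJ]] := IHn (x |: I) _ ixI.
- by move: ltn; rewrite cardsU1 xI ltnS; apply: leq_trans; rewrite ltn_sub2l.
- by rewrite subUset sub1set (subsetP BA).
by exists J; split=> //; apply: subset_trans sJ; apply: subsetUr.
Qed.

Lemma sub_mclosure A : A \subset mclosure A.
Proof. by apply/subsetP => x xA; rewrite inE (setUidPr _) ?sub1set. Qed.

Lemma mclosureS A B : A \subset B -> mclosure A \subset mclosure B.
Proof.
move=> AB; apply/subsetP => x; rewrite !inE => /eqP xA.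
rewrite eqn_leq (mrankS (subsetUr _ _)) andbT leqNgt; apply/negP => ltB.
have [I [iI IA eI]] := mrank_basis A.
have [J [iJ IJ JB eJ]] := basis_extend iI (subset_trans IA AB).
have JxB : J \subset x |: B by apply: subset_trans JB (subsetUr _ _).
have [K [iK JK KxB eK]] := basis_extend iJ JxB.
have xK : x \in K.
  apply/negPn/negP => xK; move: ltB; rewrite ltnNge => /negP; apply.
  rewrite -eK; apply: mrank_ge => //; apply/subsetP => y yK.
  have := subsetP KxB _ yK; rewrite !inE => /predU1P[yx|//].
  by rewrite -yx yK in xK.
have xnJ : x \notin J.
  apply/negP => xJ; move: ltB; rewrite (_ : x |: B = B) ?ltnn //.
  by apply/setUidPr; rewrite sub1set (subsetP JB).
have ixI : indep M (x |: I).
  by apply: indepS iK; rewrite subUset sub1set xK (subset_trans IJ JK).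
have xnI : x \notin I by apply: contra xnJ; apply: (subsetP IJ).
have := @mrank_ge _ (x |: A) ixI (setUS _ IA).
by rewrite cardsU1 xnI eI xA add1n ltnn.
Qed.

Lemma mrank_closure A : mrank (mclosure A) = mrank A.
Proof.
apply/eqP; rewrite eqn_leq (mrankS (sub_mclosure A)) andbT leqNgt.
apply/negP => ltA.
have [I [iI IA eI]] := mrank_basis A.
have [J [iJ JA eJ]] := mrank_basis (mclosure A).
have [|x /[!inE] /andP[xI xJ] ixI] := @indep_aug _ M I J iI iJ.
  by rewrite eI eJ.
have := subsetP JA _ xJ; rewrite inE => /eqP xA.
have := @mrank_ge _ (x |: A) ixI (setUS _ IA).
by rewrite cardsU1 xI eI xA add1n ltnn.
Qed.

Lemma mclosureK A : mclosure (mclosure A) = mclosure A.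
Proof.
apply/eqP; rewrite eqEsubset sub_mclosure andbT.
apply/subsetP => x; rewrite inE => /eqP xA; rewrite inE.
rewrite eqn_leq [X in _ && X]mrankS ?subsetUr // andbT -(mrank_closure A) -xA.
exact/mrankS/setUS/sub_mclosure.
Qed.

Lemma mclosure_flat A : is_flat (mclosure A).
Proof. by rewrite /is_flat mclosureK. Qed.

Lemma mclosure_sub A B : is_flat B -> (mclosure A \subset B) = (A \subset B).
Proof.
move=> /eqP fB; apply/idP/idP => [|/mclosureS]; last by rewrite fB.
exact/subset_trans/sub_mclosure.
Qed.

End RankClosure.

Record flat (E : finType) (M : matroid E) := Flat {
  flat_set :> {set E};
  flatP : is_flat M flat_set
}.

HB.instance Definition _ E M := [isSub for @flat_set E M].
HB.instance Definition _ E M := [Finite of @flat E M by <:].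

Fact flat_display : Order.disp_t. Proof. exact: (Order.Disp tt tt). Qed.

Definition closure_flat (E : finType) (M : matroid E) (A : {set E}) : flat M :=
  Flat (mclosure_flat M A).

Section FlatLattice.
Variables (E : finType) (M : matroid E).
Implicit Types x y z : flat M.

Let fle x y := flat_set x \subset flat_set y.
Let fmeet x y := closure_flat M (x :&: y).
Let fjoin x y := closure_flat M (x :|: y).

Fact flat_le_refl : reflexive fle. Proof. by move=> x; apply: subxx. Qed.
Fact flat_le_anti : antisymmetric fle.
Proof. by move=> x y; rewrite /fle -eqEsubset => /eqP/val_inj. Qed.
Fact flat_le_trans : transitive fle.
Proof. by move=> y x z; apply: subset_trans. Qed.

HB.instance Definition _ := Order.Le_isPOrder.Build flat_display (flat M)
  flat_le_refl flat_le_anti flat_le_trans.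

Fact flatI x y : mclosure M (x :&: y) = x :&: y.
Proof.
apply/eqP; rewrite eqEsubset sub_mclosure andbT subsetI.
by rewrite !(mclosure_sub _ (flatP _)) subsetIl subsetIr.
Qed.
Fact flat_meetP x y z : fle x (fmeet y z) = fle x y && fle x z.
Proof. by rewrite /fle /= flatI subsetI. Qed.
Fact flat_joinP x y z : fle (fjoin x y) z = fle x z && fle y z.
Proof. by rewrite /fle /= (mclosure_sub _ (flatP z)) subUset. Qed.

HB.instance Definition _ :=
  Order.POrder_MeetJoin_isLattice.Build flat_display (flat M)
    flat_meetP flat_joinP.

Fact flat_le0 x : fle (closure_flat M set0) x.
Proof. by rewrite /fle /= (mclosure_sub _ (flatP x)) sub0set. Qed.
Fact flat_le1 x : fle x (closure_flat M [set: E]).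
Proof. exact: subset_trans (subsetT _) (sub_mclosure M _). Qed.

HB.instance Definition _ := Order.hasBottom.Build flat_display (flat M) flat_le0.
HB.instance Definition _ := Order.hasTop.Build flat_display (flat M) flat_le1.

Lemma flat_leE x y : (x <= y)%O = (flat_set x \subset flat_set y).
Proof. by []. Qed.

Definition rk x : nat := mrank M x.

Definition Wnum (k : nat) : nat := #|[set x : flat M | rk x == k]|.

(* When M is simple, [atom] is a bijection from E to the set of atoms of the
   lattice of flats: see [atom_inj] and [atomP]. *)
Definition atom (a : E) : flat M := closure_flat M [set a].

Lemma atom_le (a : E) x : (atom a <= x)%O = (a \in flat_set x).
Proof. by rewrite flat_leE /= (mclosure_sub _ (flatP x)) sub1set. Qed.

Lemma simple_closure0 : simple_matroid M -> mclosure M set0 = set0.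
Proof.
move=> [s1 _]; apply/setP => a; rewrite !inE setU0.
have /eqP -> : mrank M set0 == 0%N.
  rewrite -leqn0; apply/bigop.bigmax_leqP => I /andP[_].
  by rewrite subset0 => /eqP->; rewrite cards0.
by apply/negbTE; rewrite -lt0n; apply: leq_trans (mrank_ge (s1 a) (subxx _));
  rewrite cards1.
Qed.

Lemma simple_closure1 (a : E) :
  simple_matroid M -> mclosure M [set a] = [set a].
Proof.
move=> [_ s2]; apply/eqP; rewrite eqEsubset sub_mclosure andbT.
apply/subsetP => b; rewrite !inE; apply: contraLR => ba.
rewrite neq_ltn; apply/orP; right.
apply: leq_trans (mrank_ge (s2 _ _ ba) (subxx _)).
rewrite cards2 ba ltnS; apply/bigop.bigmax_leqP => I /andP[_ /subset_leq_card].
by rewrite cards1.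
Qed.

Lemma atom_inj : simple_matroid M -> injective atom.
Proof.
move=> s a b /(congr1 (@flat_set _ _)) /=.
by rewrite !simple_closure1 // => /set1_inj.
Qed.

Lemma atomP x : simple_matroid M ->
  reflect (exists a, x = atom a)
    [&& (\bot < x)%O & [forall y : flat M, (\bot < y <= x)%O ==> (y == x)]].
Proof.
move=> s.
have bot_lt y : (\bot < y)%O = (flat_set y != set0).
  rewrite lt0x; congr (~~ _); apply/eqP/eqP => [->|y0].
    by rewrite /= simple_closure0.
  by apply/val_inj; rewrite /= simple_closure0.
apply: (iffP andP) => [[x0 /forallP min_x] | [a ->]].
  move: x0; rewrite bot_lt => /set0Pn[a ax]; exists a.
  apply/esym/eqP; apply: (implyP (min_x (atom a))).
  rewrite atom_le ax andbT bot_lt /= simple_closure1 //.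
  by apply/set0Pn; exists a; rewrite inE.
split.
  rewrite bot_lt /= simple_closure1 //; apply/set0Pn; exists a.
  by rewrite inE.
apply/forallP => y; apply/implyP; rewrite bot_lt flat_leE /=.
rewrite simple_closure1 // subset1 => /andP[/negbTE ->]; rewrite orbF => /eqP ya.
by apply/eqP/val_inj; rewrite /= simple_closure1.
Qed.

Definition atom_bases (x : flat M) : {set (rk x).-tuple E} :=
  [set t : (rk x).-tuple E | (\join_(a <- t) atom a)%O == x].

Definition beta (x : flat M) : nat := #|atom_bases x|.

Lemma beta_gt0 x : (0 < beta x)%N.
Proof.
have [I [iI Ix eI]] := mrank_basis M x.
have sz : size (enum I) == rk x by rewrite -cardE eI.
apply/card_gt0P; exists (Tuple sz); rewrite inE; apply/eqP/le_anti/andP; split.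
  by apply/joinsP_seq => a /=; rewrite mem_enum atom_le => /(subsetP Ix).
rewrite flat_leE; set y := (\join_(a <- _) atom a)%O.
have Iy : I \subset y.
  apply/subsetP => a aI; rewrite -atom_le /y.
  by apply: (@joins_sup_seq _ _ _ _ predT); rewrite //= mem_enum.
have eIx : mrank M I = mrank M x.
  by apply/eqP; rewrite eqn_leq mrankS // -eI mrank_ge.
apply: subset_trans (_ : mclosure M I \subset y); last first.
  by rewrite mclosure_sub // flatP.
apply/subsetP => z zx; rewrite inE eqn_leq [X in _ && X]mrankS ?subsetUr //.
by rewrite andbT eIx mrankS // subUset sub1set zx.
Qed.

End FlatLattice.

Section FlatSpace.
Variables (R : realType) (E : finType) (M : matroid E).
Implicit Types x y : flat M.

(* R^o rather than R, to get the instance of vector space over R. *)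
Definition fspace : vectType R := {ffun flat M -> R^o}.

Definition fbasis x : fspace := [ffun y => (y == x)%:R].

Definition fext (f : flat M -> fspace) : 'End(fspace) :=
  linfun (fun u : fspace => \sum_x (u : {ffun flat M -> R^o}) x *: f x).

Lemma fextE f (u : fspace) :
  fext f u = \sum_x (u : {ffun flat M -> R^o}) x *: f x.
Proof.
have lin : linear (fun u : fspace =>
    \sum_x (u : {ffun flat M -> R^o}) x *: f x).
  move=> c v w; rewrite scaler_sumr -big_split /=; apply: eq_bigr => x _.
  by rewrite !ffunE scalerDl scalerA.
pose aux := GRing.isLinear.Build R fspace fspace _ _ lin.
pose F : {linear fspace -> fspace} := HB.pack (fun u : fspace =>
    \sum_x (u : {ffun flat M -> R^o}) x *: f x) aux.
exact: (lfunE F u).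
Qed.

Lemma fext_basis f x : fext f (fbasis x) = f x.
Proof.
rewrite fextE (bigD1 x) //= ffunE eqxx scale1r big1 ?addr0 // => y yx.
by rewrite ffunE (negbTE yx) scale0r.
Qed.

Definition dot_beta (u v : fspace) : R :=
  \sum_x (u : {ffun flat M -> R^o}) x * (v : {ffun flat M -> R^o}) x
         / (beta x)%:R.

Lemma dot_beta_basis x y :
  dot_beta (fbasis x) (fbasis y) = (x == y)%:R / (beta x)%:R.
Proof.
rewrite /dot_beta (bigD1 x) //= !ffunE eqxx mul1r big1 ?addr0 // => z zx.
by rewrite ffunE (negbTE zx) !mul0r.
Qed.

Definition is_adjoint (f g : 'End(fspace)) : Prop :=
  forall u v, dot_beta (f u) v = dot_beta u (g v).

(* The value 0 of [xget] is never used: see [adjointP] and [adjoint_unique]. *)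
Definition adjoint (f : 'End(fspace)) : 'End(fspace) :=
  classical_sets.xget 0 (is_adjoint f).

Lemma dot_betaC u v : dot_beta u v = dot_beta v u.
Proof. by apply: eq_bigr => x _; rewrite [X in X / _]mulrC. Qed.

Lemma dot_beta_basisl x (v : fspace) :
  dot_beta (fbasis x) v = (v : {ffun flat M -> R^o}) x / (beta x)%:R.
Proof.
rewrite /dot_beta (bigD1 x) //= ffunE eqxx mul1r big1 ?addr0 // => z zx.
by rewrite ffunE (negbTE zx) !mul0r.
Qed.

Lemma dot_beta_suml (I : finType) (c : I -> R) (w : I -> fspace) v :
  dot_beta (\sum_i c i *: w i) v = \sum_i c i * dot_beta (w i) v.
Proof.
under [RHS]eq_bigr do rewrite /dot_beta mulr_sumr.
rewrite exchange_big /=; apply: eq_bigr => x _.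
rewrite sum_ffunE !mulr_suml; apply: eq_bigr => i _.
by rewrite ffunE /= !mulrA.
Qed.

Lemma fbasis_sum (u : fspace) :
  u = \sum_x (u : {ffun flat M -> R^o}) x *: fbasis x.
Proof.
apply/ffunP => y; rewrite sum_ffunE (bigD1 y) //= big1 => [|x xy].
  by rewrite !ffunE eqxx addr0 /GRing.scale /= mulr1.
by rewrite !ffunE eq_sym (negbTE xy) /GRing.scale /= mulr0.
Qed.

Lemma beta_neq0 x : (beta x)%:R != 0 :> R.
Proof. by rewrite pnatr_eq0 -lt0n beta_gt0. Qed.

Lemma adjoint_exists (f : 'End(fspace)) : exists g, is_adjoint f g.
Proof.
exists (fext (fun y => \sum_x
  ((beta x)%:R * dot_beta (f (fbasis x)) (fbasis y)) *: fbasis x)) => u v.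
rewrite [in LHS](fbasis_sum u) linear_sum /=.
under eq_bigr do rewrite linearZ /=.
rewrite dot_beta_suml [in RHS](fbasis_sum u) dot_beta_suml.
apply: eq_bigr => x _; congr (_ * _).
rewrite [in LHS](fbasis_sum v) dot_betaC dot_beta_suml.
rewrite fextE dot_betaC dot_beta_suml; apply: eq_bigr => y _; congr (_ * _).
rewrite dot_beta_suml (bigD1 x) //= big1 => [|z zx].
  by rewrite dot_beta_basis eqxx addr0 mul1r mulrAC divff ?beta_neq0 //
    mul1r dot_betaC.
by rewrite dot_beta_basis (negbTE zx) mul0r mulr0.
Qed.

Lemma adjointP (f : 'End(fspace)) : is_adjoint f (adjoint f).
Proof. exact: (classical_sets.xgetPex 0 (adjoint_exists f)). Qed.

Lemma adjoint_unique (f g h : 'End(fspace)) :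
  is_adjoint f g -> is_adjoint f h -> g = h.
Proof.
move=> fg fh; apply/lfunP => v; apply/ffunP => x.
have := esym (fg (fbasis x) v); rewrite fh !dot_beta_basisl.
by apply: mulIf; rewrite invr_neq0 ?beta_neq0.
Qed.

Definition Lop (a : E) : 'End(fspace) :=
  fext (fun x => if (atom M a <= x)%O then 0 else fbasis (x `|` atom M a)%O).

Definition Lbeta (a : E) : 'End(fspace) := adjoint (Lop a).

Definition vlevel (k : nat) : fspace :=
  \sum_(x : flat M | rk x == k) (beta x)%:R *: fbasis x.

Definition Ubeta : 'End(fspace) := \sum_(a : E) Lbeta a.

Definition Kop : 'End(fspace) := fext (fun x => (rk x)%:R *: fbasis x).

Definition sdef x : R :=
  #|E|%:R - #|[set a : E | (atom M a <= x)%O]|%:R.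

Definition Sinv : 'End(fspace) :=
  fext (fun x => if (x < \top)%O then (sdef x)^-1 *: fbasis x else 0).

Definition Dbeta : 'End(fspace) := (Sinv \o Ubeta \o Kop)%VF.

Definition vtop : fspace := vlevel (mrank M [set: E]).

Fixpoint Cbeta (k : nat) : {vspace fspace} :=
  if k is k'.+1 then
    (Dbeta @: Cbeta k' + \sum_(a : E) (Lbeta a @: Cbeta k'))%VS
  else <[vtop]>%VS.

Definition hbeta (k : nat) : nat := \dim (Cbeta k).

(* For t = (a_1, ..., a_k), the operator of a_1 is applied first. *)
Definition word0 (t : seq E) : fspace :=
  foldl (fun v a => Lbeta a v) vtop t.

Definition Czero (k : nat) : {vspace fspace} :=
  <<[seq word0 (t : k.-tuple E) | t : k.-tuple E]>>%VS.

Definition hzero (k : nat) : nat := \dim (Czero k).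

End FlatSpace.

(* Main.v *)
Require Import Defs.
From mathcomp Require Import all_boot all_order all_algebra.
From mathcomp Require Import reals.

(** Everything rests on one coordinate formula, [Lbeta_coord]: the coordinate
    of [Lbeta a u] at a flat [x] vanishes if [a] lies in [x], and is otherwise
    a positive multiple of the coordinate of [u] at the cover [x `|` atom a].

    Read as a statement on supports, it says that [Lbeta a] lowers ranks by
    exactly one ([Lbeta_graded]). Since [Kop] and [Sinv] are diagonal, [Dbeta]
    lowers ranks by one too, so [Cbeta k] lives on the flats of corank [k], and
    its dimension is at most their number. That [Czero k] lies in [Cbeta k] is
    clear, because words in the [Lbeta a] are among the products that build
    [Cbeta k].

    Read as a statement on nonvanishing, it says that a word whose letters
    climb from [x] to the top along a maximal chain has a nonzero coordinate at
    [x] ([word0_coord_neq0]). For the bottom flat this makes [Czero r] nonzero,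
    whence the values at [k = 0] and [k = r]: there is only one flat of rank
    [r] and only one of rank [0]. *)

Set Implicit Arguments.
Unset Strict Implicit.
Unset Printing Implicit Defensive.

Import Order.TTheory GRing.Theory Num.Theory.

(** * Ranks of flats *)

Section FlatRank.
Variables (E : finType) (M : matroid E).
Implicit Types (A : {set E}) (x y : flat M).

Lemma mrankU1_le (a : E) A : mrank M (a |: A) <= (mrank M A).+1.
Proof.
have [I [iI IA <-]] := mrank_basis M (a |: A).
rewrite (cardsD1 a) -add1n leq_add ?leq_b1 //; apply: mrank_ge.
  exact: indepS (subsetDl _ _) iI.
by rewrite subDset.
Qed.

Lemma mrankU1_flat (a : E) x : a \notin flat_set x ->
  mrank M (a |: x) = (rk x).+1.
Proof.
move=> ax; apply/eqP; rewrite eqn_leq mrankU1_le ltn_neqAle /= mrankS ?subsetUr //.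
rewrite andbT eq_sym; apply: contra ax => eq_r.
by rewrite -(eqP (flatP x)) inE.
Qed.

Lemma rk_join_atom (a : E) x : ~~ (atom M a <= x)%O ->
  rk (x `|` atom M a)%O = (rk x).+1.
Proof.
rewrite atom_le => ax; rewrite -(mrankU1_flat ax).
have le_cl : (x `|` atom M a <= closure_flat M (a |: x))%O.
  rewrite leUx atom_le flat_leE /= !(subset_trans _ (sub_mclosure M _)) ?subsetUr //=.
  by apply: (subsetP (sub_mclosure M _)); rewrite setU11.
apply/eqP; rewrite eqn_leq /rk -[X in _ <= X](mrank_closure M) !mrankS //.
by rewrite subUset sub1set -atom_le leUr -flat_leE leUl.
Qed.

Lemma flat_eq_rk x y : (x <= y)%O -> rk y <= rk x -> x = y.
Proof.
move=> xy rk_yx; apply/le_anti; rewrite xy /= flat_leE.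
apply/subsetP => a ay; apply/negPn/negP => /mrankU1_flat rk_ax.
have: mrank M (a |: x) <= rk y by apply: mrankS; rewrite subUset sub1set ay.
by rewrite rk_ax ltnNge rk_yx.
Qed.

Lemma rk_top : rk (\top%O : flat M) = mrank M [set: E].
Proof. exact: mrank_closure. Qed.

Lemma rk_bot : rk (\bot%O : flat M) = 0.
Proof.
rewrite /rk mrank_closure; apply/eqP; rewrite -leqn0.
by apply/bigop.bigmax_leqP => I /andP[_]; rewrite subset0 => /eqP->; rewrite cards0.
Qed.

Lemma Wnum0 : Wnum M 0 = 1.
Proof.
rewrite /Wnum -(cards1 (\bot%O : flat M)); congr #|pred_of_set _|.
apply/setP => x; rewrite !inE; apply/eqP/eqP => [x0 | ->]; last exact: rk_bot.
by apply/esym/flat_eq_rk; rewrite ?le0x // x0.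
Qed.

Lemma Wnum_top : Wnum M (mrank M [set: E]) = 1.
Proof.
rewrite /Wnum -(cards1 (\top%O : flat M)); congr #|pred_of_set _|.
apply/setP => x; rewrite !inE; apply/eqP/eqP => [xr | ->]; last exact: rk_top.
by apply/flat_eq_rk; rewrite ?lex1 // xr rk_top.
Qed.

End FlatRank.

Local Open Scope ring_scope.

(** * Coordinates of the operators *)

Section Coordinates.
Variables (R : realType) (E : finType) (M : matroid E).
Local Notation V := (fspace R M).
Implicit Types (u : V) (x : flat M) (a : E).

Definition coord_at u x : R := (u : {ffun flat M -> R^o}) x.

Lemma coord_atD u w x : coord_at (u + w) x = coord_at u x + coord_at w x.
Proof. by rewrite /coord_at ffunE. Qed.

Lemma coord_at_sum (I : finType) (P : pred I) (c : I -> R) (w : I -> V) x :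
  coord_at (\sum_(i | P i) c i *: w i) x = \sum_(i | P i) c i * coord_at (w i) x.
Proof. by rewrite /coord_at sum_ffunE; apply: eq_bigr => i _; rewrite ffunE. Qed.

Lemma coord_at_basis x y : coord_at (fbasis R y) x = (x == y)%:R.
Proof. by rewrite /coord_at ffunE. Qed.

Lemma coord_at_diag (c : flat M -> R) u x :
  coord_at (fext (fun y => c y *: fbasis R y) u) x = coord_at u x * c x.
Proof.
rewrite fextE; under eq_bigr do rewrite scalerA.
rewrite coord_at_sum (bigD1 x) //= coord_at_basis eqxx mulr1 big1 ?addr0 // => y.
by rewrite coord_at_basis eq_sym => /negbTE ->; rewrite mulr0.
Qed.

(** The coordinate of a vector at [x] is, up to the factor [beta x], its inner
    product with the basis vector of [x]; adjunction moves the operator there,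
    where its value is known. *)
Lemma Lbeta_coord a u x :
  coord_at (Lbeta R M a u) x =
    if (atom M a <= x)%O then 0
    else (beta x)%:R / (beta (x `|` atom M a)%O)%:R
         * coord_at u (x `|` atom M a)%O.
Proof.
have b0 := beta_neq0 R x.
have := adjointP (Lop R M a) (fbasis R x) u.
rewrite -/(Lbeta R M a) dot_beta_basisl -/(coord_at _ x) => /esym/(canRL (mulfVK b0)) ->.
rewrite /Lop fext_basis; case: ifP => _; last first.
  by rewrite dot_beta_basisl -/(coord_at _ _) mulrC mulrA mulrAC.
by rewrite /dot_beta big1 ?mul0r // => y _; rewrite ffunE !mul0r.
Qed.

(** * Grading by corank *)

Let r := mrank M [set: E].

(** A sum of ranks rather than a truncated difference: for [k > r] only the
    zero vector qualifies, so that the lemmas below hold for every [k]. *)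
Definition graded (k : nat) u : Prop :=
  forall x, coord_at u x != 0 -> (rk x + k)%N = r.

Lemma gradedD k u w : graded k u -> graded k w -> graded k (u + w).
Proof.
move=> gu gw x; have [u0|/gu //] := eqVneq (coord_at u x) 0.
by rewrite coord_atD u0 add0r => /gw.
Qed.

Lemma graded0 k : graded k 0.
Proof. by move=> x; rewrite /coord_at ffunE eqxx. Qed.

Lemma graded_sum (I : finType) k (w : I -> V) :
  (forall i, graded k (w i)) -> graded k (\sum_i w i).
Proof.
by move=> gw; elim/big_ind: _ => // [|u v]; [apply: graded0 | apply: gradedD].
Qed.

Lemma graded_diag (c : flat M -> R) k u :
  graded k u -> graded k (fext (fun y => c y *: fbasis R y) u).
Proof.
by move=> gu x; rewrite coord_at_diag mulf_eq0 negb_or => /andP[/gu].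
Qed.

Lemma Lbeta_graded a k u : graded k u -> graded k.+1 (Lbeta R M a u).
Proof.
move=> gu x; rewrite Lbeta_coord; case: ifPn => [_ | ax]; first by rewrite eqxx.
rewrite mulf_eq0 negb_or => /andP[_ /gu].
by rewrite rk_join_atom // addSnnS.
Qed.

Lemma Sinv_graded k u : graded k u -> graded k (Sinv R M u).
Proof.
move=> gu; have -> : Sinv R M u = fext (fun y =>
    (if (y < \top)%O then (sdef R y)^-1 else 0) *: fbasis R y) u.
  by rewrite !fextE; apply: eq_bigr => y _; case: ifP => //; rewrite scale0r.
exact: graded_diag.
Qed.

Lemma Dbeta_graded k u : graded k u -> graded k.+1 (Dbeta R M u).
Proof.
move=> gu; rewrite /Dbeta !comp_lfunE /=; apply: Sinv_graded.
rewrite /Ubeta sum_lfunE; apply: graded_sum => a.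
exact/Lbeta_graded/graded_diag.
Qed.

Lemma vtop_coord x : coord_at (vtop R M) x = if rk x == r then (beta x)%:R else 0.
Proof.
rewrite /vtop /vlevel coord_at_sum; under eq_bigr do rewrite coord_at_basis.
case: ifPn => [xr | xr].
  rewrite (bigD1 x) //= eqxx mulr1 big1 ?addr0 // => y /andP[_].
  by rewrite eq_sym => /negbTE ->; rewrite mulr0.
rewrite big1 // => y yr; case: eqP => [xy|_]; last by rewrite mulr0.
by rewrite xy yr in xr.
Qed.

Lemma Cbeta_graded k u : u \in Cbeta R M k -> graded k u.
Proof.
elim: k u => [|k IHk] u /=.
  case/vlineP => c -> x.
  rewrite /coord_at ffunE -/(coord_at _ x) vtop_coord addn0.
  by case: ifP => [/eqP //|_]; rewrite scaler0 eqxx.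
case/memv_addP => _ /memv_imgP[v /IHk gv ->] [_ /memv_sumP[w mem_w ->] ->].
apply: gradedD; first exact: Dbeta_graded.
apply: graded_sum => a; have /memv_imgP[v' /IHk gv' ->] := mem_w a isT.
exact: Lbeta_graded.
Qed.

(** * The dimension bounds *)

Lemma hbeta_le_Wnum k : (hbeta R M k <= Wnum M (r - k))%N.
Proof.
pose X := [seq fbasis R x | x in [set x : flat M | rk x == (r - k)%N]].
have <- : size X = Wnum M (r - k) by rewrite size_map -cardE.
apply: leq_trans (dim_span X); apply: dimvS; apply/subvP => u /Cbeta_graded gu.
rewrite (fbasis_sum u); apply: memv_suml => x _.
have [u0|/gu rkx] := eqVneq (coord_at u x) 0.
  by rewrite -/(coord_at u x) u0 scale0r mem0v.
apply/memvZ/memv_span/map_f.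
by rewrite mem_enum inE -rkx addnK.
Qed.

Lemma word0_rcons (s : seq E) a : word0 R M (rcons s a) = Lbeta R M a (word0 R M s).
Proof. by rewrite /word0 foldl_rcons. Qed.

Lemma word0_Cbeta (s : seq E) : word0 R M s \in Cbeta R M (size s).
Proof.
elim/last_ind: s => [|s a IHs]; first exact: memv_line.
rewrite word0_rcons size_rcons /=; apply: (subvP (addvSr _ _)).
by apply: (subvP (sumv_sup a _ (subvv _))) => //; apply: memv_img.
Qed.

Lemma hzero_le_hbeta k : (hzero R M k <= hbeta R M k)%N.
Proof.
apply/dimvS/span_subvP => _ /imageP[t _ ->].
by rewrite -[X in Cbeta R M X](size_tuple t) word0_Cbeta.
Qed.

(** The letters are chosen while climbing from [x] to the top: any atom outside
    [x] serves as the last letter, and the rest is a word for the flat which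
    that atom and [x] span. *)
Lemma word0_coord_neq0 x :
  exists2 s, size s = (r - rk x)%N & coord_at (word0 R M s) x != 0.
Proof.
have [n def_n] : exists n, n = (r - rk x)%N by exists (r - rk x)%N.
elim: n x def_n => [|n IHn] x def_n; rewrite -def_n.
  exists [::] => //; rewrite /word0 /= vtop_coord.
  suff -> : rk x == r by exact: beta_neq0.
  by rewrite eqn_leq mrankS ?subsetT //= -subn_eq0 -def_n.
have [a _ ax] : exists2 a, a \in [set: E] & a \notin flat_set x.
  apply/subsetPn; apply/negP => /(mrankS M) le_rx.
  by move: le_rx def_n; rewrite -subn_eq0 -/r -/(rk x) => /eqP->.
rewrite -atom_le in ax.
have [|s size_s s0] := IHn (x `|` atom M a)%O.
  by rewrite rk_join_atom // subnS -def_n.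
exists (rcons s a).
  by rewrite size_rcons size_s rk_join_atom // subnS -def_n.
by rewrite word0_rcons Lbeta_coord (negbTE ax) !mulf_neq0 ?invr_neq0 ?beta_neq0.
Qed.

Lemma hbeta_r_gt0 : (0 < hbeta R M r)%N.
Proof.
have [s size_s s0] := word0_coord_neq0 \bot%O.
rewrite rk_bot subn0 in size_s; rewrite /hbeta lt0n dimv_eq0.
apply: contraNneq s0 => C0.
have := word0_Cbeta s; rewrite size_s C0 memv0 => /eqP ->.
by rewrite /coord_at ffunE.
Qed.

Lemma hbeta_0_gt0 : (0 < hbeta R M 0)%N.
Proof.
rewrite /hbeta /= dim_vline lt0b.
suff: coord_at (vtop R M) \top%O != 0.
  by apply: contraNneq => ->; rewrite /coord_at ffunE.
by rewrite vtop_coord rk_top eqxx beta_neq0.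
Qed.

End Coordinates.

Local Close Scope ring_scope.

Theorem proposition2p7 (R : realType) (E : finType) (M : matroid E) (r : nat)
    (hM : simple_matroid M) (hr : mrank M [set: E] = r) :
  (forall k : nat, k <= r ->
     hzero R M k <= hbeta R M k /\ hbeta R M k <= Wnum M (r - k)) /\
  hbeta R M 0 = 1 /\ hbeta R M r = 1.
Proof.
rewrite -hr; split=> [k _|]; first by split; [exact: hzero_le_hbeta | exact: hbeta_le_Wnum].
split; apply/eqP; rewrite eqn_leq ?hbeta_r_gt0 ?hbeta_0_gt0 andbT.
  by have := hbeta_le_Wnum R M 0; rewrite subn0 Wnum_top.
by have := hbeta_le_Wnum R M (mrank M [set: E]); rewrite subnn Wnum0.
Qed.
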